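(* Let $c\ge1$, let $G$ be a finite nilpotent group of class $t\ge2$, and let $G\cong F/R$ be a free presentation. Then (i) $|\gamma_{c+1}(G)|\,|M^{(c)}(G)|=|M^{(c)}(G/G')|\prod_{k=1}^{t-1}\left|[\gamma_{k+1}(F)R,{}_cF]/[\gamma_{k+2}(F)R,{}_cF]\right|$; (ii) $\exp(M^{(c)}(G))$ divides $\exp(M^{(c)}(G/G'))\prod_{k=1}^{t-1}\exp\left([\gamma_{k+1}(F)R,{}_cF]/[\gamma_{k+2}(F)R,{}_cF]\right)$; (iii) $d(M^{(c)}(G))\le d(M^{(c)}(G/G'))+\sum_{k=1}^{t-1}d\left([\gamma_{k+1}(F)R,{}_cF]/[\gamma_{k+2}(F)R,{}_cF]\right)$.
   Context: $\gamma_1(X)=X$, $\gamma_{i+1}(X)=[\gamma_i(X),X]$; $G'=\gamma_2(G)$. For subgroups $U,V$, $[U,{}_0V]=U$, $[U,{}_{i+1}V]=[[U,{}_iV],V]$. The $c$-nilpotent multiplier of $G\cong F/R$ ($F$ free) is $M^{(c)}(G)=(R\cap\gamma_{c+1}(F))/[R,{}_cF]$, independent of the presentation. $d(X)$ is the minimal number of generators and $\exp(X)$ the exponent. *)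

(* Defs.v *)
From Stdlib Require Import ClassicalEpsilon.
From mathcomp Require Import all_boot all_fingroup all_solvable.
Set Implicit Arguments. Unset Strict Implicit. Unset Printing Implicit Defensive.

Record grp := Grp {
  gcar :> Type;
  gmul : gcar -> gcar -> gcar;
  gone : gcar;
  ginv : gcar -> gcar;
  gmulA : forall x y z, gmul x (gmul y z) = gmul (gmul x y) z;
  gmul1 : forall x, gmul gone x = x;
  gmulV : forall x, gmul (ginv x) x = gone }.
Arguments gmul {g}. Arguments gone {g}. Arguments ginv {g}.

Definition is_hom (F H : grp) (f : F -> H) : Prop :=
  forall x y, f (gmul x y) = gmul (f x) (f y).

Definition is_free (F : grp) : Prop :=
  exists X : F -> Prop, forall (H : grp) (f : F -> H),
    exists h : F -> H, (is_hom h /\ forall x, X x -> h x = f x) /\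
      forall h' : F -> H, is_hom h' -> (forall x, X x -> h' x = f x) ->
        forall x, h' x = h x.

Definition is_hom_fin (F : grp) (gT : finGroupType) (f : F -> gT) : Prop :=
  forall x y, f (gmul x y) = (f x * f y)%g.

Section Subgroups.
Variable F : grp.
Definition fset := F -> Prop.

Definition fullF : fset := fun _ => True.
Definition capF (U V : fset) : fset := fun x => U x /\ V x.

Inductive gen (S : fset) : fset :=
| gen_in x : S x -> gen S x
| gen_one : gen S gone
| gen_mul x y : gen S x -> gen S y -> gen S (gmul x y)
| gen_inv x : gen S x -> gen S (ginv x).

Definition gcomm (x y : F) : F := gmul (gmul (ginv x) (ginv y)) (gmul x y).

Definition commF (U V : fset) : fset :=
  gen (fun z => exists u v, U u /\ V v /\ z = gcomm u v).

(* join UV (for R normal this is the product subgroup) *)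
Definition joinF (U V : fset) : fset := gen (fun x => U x \/ V x).

(* lower central series: gammaF 1 = F, gammaF (i+1) = [gammaF i, F];
   (gammaF 0 = F is an irrelevant convention) *)
Fixpoint gammaF (n : nat) : fset :=
  match n with
  | 0 => fullF
  | S m => if m is 0 then fullF else commF (gammaF m) fullF
  end.

Fixpoint citer (U : fset) (n : nat) : fset :=
  match n with 0 => U | S m => commF (citer U m) fullF end.

Fixpoint gpow (x : F) (n : nat) : F :=
  match n with 0 => gone | S m => gmul x (gpow x m) end.

Definition least (P : nat -> Prop) : nat :=
  match excluded_middle_informative
          (exists n, P n /\ forall m, P m -> n <= m) with
  | left h => proj1_sig (constructive_indefinite_description _ h)
  | right _ => 0
  end.

(* Invariants of the quotient A/B (B normal subgroup of A). *)
Definition qorder (A B : fset) (n : nat) : Prop :=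
  exists f : nat -> F,
    (forall i, i < n -> A (f i)) /\
    (forall i j, i < n -> j < n -> B (gmul (ginv (f i)) (f j)) -> i = j) /\
    (forall a, A a -> exists2 i, i < n & B (gmul (ginv (f i)) a)).
(* order of A/B (0 if infinite) *)
Definition qcard (A B : fset) : nat := least (qorder A B).
(* exponent of A/B (0 if there is no finite exponent) *)
Definition qexp (A B : fset) : nat :=
  least (fun e => 0 < e /\ forall a, A a -> B (gpow a e)).
Definition qrank (A B : fset) : nat :=
  least (fun k => exists f : nat -> F, (forall i, i < k -> A (f i)) /\
           forall a, A a -> gen (fun x => (exists2 i, i < k & x = f i) \/ B x) a).

Definition kerF (gT : finGroupType) (f : F -> gT) : fset := fun x => f x = 1%g.

(* the c-nilpotent multiplier of F/R, as the pair (numerator, denominator):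
   M^(c) = (R \cap gamma_{c+1}(F)) / [R, _c F] *)
Definition Mc_num (c : nat) (R : fset) : fset := capF R (gammaF c.+1).
Definition Mc_den (c : nat) (R : fset) : fset := citer R c.

Definition facF (c : nat) (R : fset) (k : nat) : fset :=
  citer (joinF (gammaF k.+1) R) c.
End Subgroups.

(* Main.v *)
(* Put D_k = [gamma_(k+1)(F) R, _c F].  These normal subgroups decrease from
   D_0 = gamma_(c+1)(F) through D_1 = [Rab, _c F] to D_t = [R, _c F], because
   gamma_(t+1)(F) <= R, and M^(c)(G/G') = D_0 / D_1 because gamma_(c+1)(F) <= Rab.
   As M^(c)(G) is the subgroup (R /\ gamma_(c+1)(F)) / D_t of D_0 / D_t, with index
   |gamma_(c+1)(G)|, (i) and (ii) follow by multiplying along the chain.  For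
   (iii), D_k / D_(k+1) is central in F / D_(k+1), so each of its subgroups needs
   at most d(D_k / D_(k+1)) generators.

   Since [qcard], [qexp] and [qrank] are 0 when no finite value exists, (iii) needs
   every D_k / D_(k+1) to be finitely generated even when F is not.  This holds
   because D_0 / D_t is polycyclic: a finite transversal of R generates F modulo R,
   and [R, gamma_i(F)] <= [R, _i F] (three subgroups lemma), so for i > c each
   gamma_i(F) is generated modulo gamma_(i+1)(F) D_t by finitely many commutators,
   while gamma_(t+c+1)(F) <= D_t. *)
Require Import Defs.
From Stdlib Require Import Classical ClassicalEpsilon FunctionalExtensionality PropExtensionality.
From mathcomp Require Import all_boot all_fingroup all_solvable.
From mathcomp Require Import zify.
Set Implicit Arguments. Unset Strict Implicit. Unset Printing Implicit Defensive.

(* Arithmetic in an abstract group *)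
Local Infix "**" := gmul (at level 40, left associativity).

Lemma gmulVK (F : grp) (x y : F) : ginv x ** (x ** y) = y.
Proof. by rewrite gmulA gmulV gmul1. Qed.

Lemma gmul_cancel (F : grp) (x y z : F) : x ** y = x ** z -> y = z.
Proof. by move=> e; rewrite -(gmulVK x y) e gmulVK. Qed.

Lemma gmulr1 (F : grp) (x : F) : x ** gone = x.
Proof. by apply: (@gmul_cancel _ (ginv x)); rewrite gmulA gmulV gmul1. Qed.

Lemma gmulrV (F : grp) (x : F) : x ** ginv x = gone.
Proof. by apply: (@gmul_cancel _ (ginv x)); rewrite gmulA gmulV gmul1 gmulr1. Qed.

Lemma gmulrVK (F : grp) (x y : F) : y ** ginv x ** x = y.
Proof. by rewrite -gmulA gmulV gmulr1. Qed.

Lemma gmulrK (F : grp) (x y : F) : y ** x ** ginv x = y.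
Proof. by rewrite -gmulA gmulrV gmulr1. Qed.

Lemma ginv_uniq (F : grp) (x y : F) : x ** y = gone -> y = ginv x.
Proof. by move=> e; apply: (@gmul_cancel _ x); rewrite e gmulrV. Qed.

Lemma ginvK (F : grp) (x : F) : ginv (ginv x) = x.
Proof. by symmetry; apply: ginv_uniq; rewrite gmulV. Qed.

Lemma ginv1 (F : grp) : ginv gone = gone :> F.
Proof. by symmetry; apply: ginv_uniq; rewrite gmul1. Qed.

Lemma ginvM (F : grp) (x y : F) : ginv (x ** y) = ginv y ** ginv x.
Proof. by symmetry; apply: ginv_uniq; rewrite gmulA gmulrK gmulrV. Qed.

Definition gnormE := (gmulA, ginvM, ginvK, ginv1, gmul1, gmulr1, gmulV, gmulrV,
                     gmulrVK, gmulrK).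

Lemma hom_one (F : grp) (gT : finGroupType) (f : F -> gT) :
  is_hom_fin f -> f gone = 1%g.
Proof. by move=> h; apply: (mulgI (f gone)); rewrite -h gmul1 mulg1. Qed.

Lemma hom_inv (F : grp) (gT : finGroupType) (f : F -> gT) x :
  is_hom_fin f -> f (ginv x) = (f x)^-1%g.
Proof. by move=> h; apply: (mulgI (f x)); rewrite -h gmulrV hom_one ?mulgV. Qed.

Lemma hom_comm (F : grp) (gT : finGroupType) (f : F -> gT) x y :
  is_hom_fin f -> f (gcomm x y) = [~ f x, f y]%g.
Proof.
by move=> h; rewrite /gcomm /commg /conjg !h !hom_inv // !mulgA.
Qed.

(** * Subgroups, normal and generated subgroups *)

Definition subF (F : grp) (U V : fset F) : Prop := forall x, U x -> V x.

Definition subgroupF (F : grp) (U : fset F) : Prop :=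
  [/\ U gone, forall x y, U x -> U y -> U (x ** y) & forall x, U x -> U (ginv x)].

Definition normalF (F : grp) (U : fset F) : Prop :=
  subgroupF U /\ forall x g, U x -> U (ginv g ** x ** g).

Lemma fset_eq (F : grp) (U V : fset F) : subF U V -> subF V U -> U = V.
Proof.
move=> UV VU; apply: functional_extensionality => x.
by apply: propositional_extensionality; split; [apply: UV | apply: VU].
Qed.

Lemma gen_subgroup (F : grp) (S : fset F) : subgroupF (gen S).
Proof. by split; [exact: gen_one | exact: gen_mul | exact: gen_inv]. Qed.

Lemma gen_sub (F : grp) (S U : fset F) : subgroupF U -> subF S U -> subF (gen S) U.
Proof. by case=> U1 UM UV SU x; elim=> *; auto. Qed.

Lemma gen_mono (F : grp) (S T : fset F) : subF S T -> subF (gen S) (gen T).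
Proof. by move=> ST; apply: gen_sub (gen_subgroup _) _ => x /ST; apply: gen_in. Qed.

Lemma gen_normal (F : grp) (S : fset F) :
  (forall x g, S x -> gen S (ginv g ** x ** g)) -> normalF (gen S).
Proof.
move=> Sg; split=> [|x g]; first exact: gen_subgroup.
elim=> [y /Sg //||y z _ IHy _ IHz|y _ IHy].
- by rewrite !gnormE; apply: gen_one.
- by move: (gen_mul IHy IHz); rewrite !gnormE.
- by move: (gen_inv IHy); rewrite !gnormE.
Qed.

Lemma full_normal (F : grp) : normalF (@fullF F).
Proof. by []. Qed.

Lemma cap_subgroup (F : grp) (U V : fset F) :
  subgroupF U -> subgroupF V -> subgroupF (capF U V).
Proof.
case=> U1 UM UV [V1 VM VV]; split=> [|x y [? ?] [? ?]|x [? ?]]; split; auto.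
Qed.

Lemma normal_commr (F : grp) (U : fset F) x g : normalF U -> U x -> U (gcomm x g).
Proof.
case=> -[U1 UM UV] UJ Ux; rewrite /gcomm -!gmulA; apply: (UM _ _ (UV _ Ux)).
by rewrite gmulA; apply: UJ.
Qed.

(** * Commutator calculus and iterated commutators *)

Lemma gcommV (F : grp) (x y : F) : ginv (gcomm x y) = gcomm y x.
Proof. by rewrite /gcomm !gnormE. Qed.

Lemma gcommMl (F : grp) (x y z : F) :
  gcomm (x ** y) z = ginv y ** gcomm x z ** y ** gcomm y z.
Proof. by rewrite /gcomm !gnormE. Qed.

Lemma commC (F : grp) (U : fset F) x y : subgroupF U -> U (gcomm x y) -> U (gcomm y x).
Proof. by case=> _ _ UV /UV; rewrite gcommV. Qed.

(** By [xy, v] = [x, v]^y [y, v] and normality of [K]; commutator inclusions can thus be checked on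
    generators. *)
Lemma comml_subgroup (F : grp) (K V : fset F) :
  normalF K -> subgroupF (fun u => forall v, V v -> K (gcomm u v)).
Proof.
case=> -[K1 KM KV] KJ; split=> [v _|x y Kx Ky v Vv|x Kx v Vv].
- by rewrite /gcomm !gnormE.
- by rewrite gcommMl; apply: KM; [apply: KJ; apply: Kx | apply: Ky].
- have -> : gcomm (ginv x) v = ginv (ginv x) ** ginv (gcomm x v) ** ginv x.
    by rewrite /gcomm !gnormE.
  by apply: KJ; apply: KV; apply: Kx.
Qed.

(** Inverting a commutator swaps its entries, so [comml_subgroup] applies with the one-element set
    [eq u]. *)
Lemma commr_subgroup (F : grp) (K : fset F) u :
  normalF K -> subgroupF (fun v => K (gcomm u v)).
Proof.
move=> nK; have [S1 SM SV] := comml_subgroup (eq u) nK; have sK := nK.1.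
split=> [|x y Kx Ky|x Kx]; apply: commC => //.
- exact: S1.
- by apply: SM => [v <-|v <-|]; rewrite //; apply: commC.
- by apply: SV => [v <-|]; rewrite //; apply: commC.
Qed.

Lemma gen_comml (F : grp) (K S : fset F) u v : normalF K ->
  (forall u v, S u -> K (gcomm u v)) -> gen S u -> K (gcomm u v).
Proof.
move=> nK SK gu; move: u gu v (I : fullF v).
by apply: gen_sub => [|u Su v _]; [exact: comml_subgroup | exact: SK].
Qed.

Lemma comm_in (F : grp) (U V : fset F) u v : U u -> V v -> commF U V (gcomm u v).
Proof. by move=> Uu Vv; apply: gen_in; exists u, v. Qed.

Lemma comm_sub (F : grp) (U V K : fset F) : subgroupF K ->
  (forall u v, U u -> V v -> K (gcomm u v)) -> subF (commF U V) K.
Proof. by move=> sK H; apply: gen_sub => // _ [u [v [Uu [Vv ->]]]]; apply: H. Qed.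

Lemma comm_mono (F : grp) (U U' V : fset F) : subF U U' -> subF (commF U V) (commF U' V).
Proof.
move=> UU'; apply: comm_sub (gen_subgroup _) _ => u v /UU' Uu Vv; exact: comm_in.
Qed.

Lemma comm_normal (F : grp) (U V : fset F) : normalF U -> normalF V -> normalF (commF U V).
Proof.
move=> nU nV; apply: gen_normal => _ g [u [v [Uu [Vv ->]]]].
have -> : ginv g ** gcomm u v ** g = gcomm (ginv g ** u ** g) (ginv g ** v ** g).
  by rewrite /gcomm !gnormE.
by apply: comm_in; [apply: nU.2 | apply: nV.2].
Qed.

Lemma join_normal (F : grp) (U V : fset F) : normalF U -> normalF V -> normalF (joinF U V).
Proof.
move=> nU nV; apply: gen_normal => x g [Ux|Vx]; apply: gen_in; [left | right].
  exact: nU.2.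
exact: nV.2.
Qed.

Lemma joinl (F : grp) (U V : fset F) : subF U (joinF U V).
Proof. by move=> x Ux; apply: gen_in; left. Qed.

Lemma joinr (F : grp) (U V : fset F) : subF V (joinF U V).
Proof. by move=> x Vx; apply: gen_in; right. Qed.

Lemma join_sub (F : grp) (U V W : fset F) :
  subgroupF W -> subF U W -> subF V W -> subF (joinF U V) W.
Proof. by move=> sW UW VW; apply: gen_sub => // x [/UW|/VW]. Qed.

Lemma citer_normal (F : grp) (U : fset F) n : normalF U -> normalF (citer U n).
Proof. by move=> nU; elim: n => //= n IH; apply: comm_normal. Qed.

Lemma citer_mono (F : grp) (U V : fset F) n : subF U V -> subF (citer U n) (citer V n).
Proof. by move=> UV; elim: n => //= n; apply: comm_mono. Qed.

Lemma citerS_sub (F : grp) (U : fset F) n : normalF U -> subF (citer U n.+1) (citer U n).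
Proof.
move=> nU; have nUn := citer_normal n nU.
by apply: comm_sub nUn.1 _ => u v Uu _; apply: normal_commr.
Qed.

Lemma citer_anti (F : grp) (U : fset F) m n :
  normalF U -> m <= n -> subF (citer U n) (citer U m).
Proof.
move=> nU /subnK <-; elim: (n - m) => // k IH x.
by rewrite addSn => /(citerS_sub nU) /IH.
Qed.

Lemma citerD (F : grp) (U : fset F) m n : citer U (n + m) = citer (citer U m) n.
Proof. by elim: n => //= n ->. Qed.

Lemma gammaFS (F : grp) n : @gammaF F n.+1 = citer (@fullF F) n.
Proof. by elim: n => // n IH; rewrite -[LHS]/(commF (gammaF n.+1) (@fullF F)) IH. Qed.

(** The Hall-Witt identity [x, y^-1, z]^y [y, z^-1, x]^z [z, x^-1, y]^x = 1, solved for its first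
    factor. *)
Lemma hall_witt (F : grp) (K : fset F) x y z : normalF K ->
  K (gcomm (gcomm y (ginv z)) x) -> K (gcomm (gcomm z (ginv x)) y) ->
  K (gcomm (gcomm x (ginv y)) z).
Proof.
case=> -[K1 KM KV] KJ H1 H2.
have -> : gcomm (gcomm x (ginv y)) z =
  ginv (ginv y) ** ginv ((ginv z ** gcomm (gcomm y (ginv z)) x ** z) **
       (ginv x ** gcomm (gcomm z (ginv x)) y ** x)) ** ginv y.
  by rewrite /gcomm !gnormE.
by apply: (KJ); apply: KV; apply: KM; apply: (KJ).
Qed.

(** Three subgroups lemma, by induction on [i] for all normal [U] at once: for a generator [a, b] of
    gamma_(i+2)(F), [hall_witt] leaves two commutators, covered by the induction hypothesis for
    [U, F] and for [U]. *)
Lemma comm_citer (F : grp) (U : fset F) i x u : normalF U ->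
  citer (@fullF F) i x -> U u -> citer U i.+1 (gcomm u x).
Proof.
elim: i U x u => [|i IH] U x u nU; first by move=> _ Uu; apply: comm_in.
have nV := citer_normal i.+2 nU => xi Uu.
apply: commC nV.1 _; move: x xi u Uu.
apply: gen_sub; first exact: comml_subgroup.
move=> _ [a [b [ai [_ ->]]]] u Uu; rewrite -[b]ginvK.
have nC : normalF (commF U (@fullF F)) by apply: comm_normal.
apply: hall_witt => //.
- have Cbu : commF U (@fullF F) (gcomm (ginv b) (ginv u)).
    by apply: commC nC.1 _; apply: comm_in => //; case: nU => -[_ _ UV] _; apply: UV.
  by have := IH _ _ _ nC ai Cbu; rewrite -(citerD U 1) addn1.
- apply: comm_in => //; apply: IH => //.
  by case: (citer_normal i (full_normal F)) => -[_ _ gV] _; apply: gV.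
Qed.

(** * Least values and powers *)

Lemma ex_least (P : nat -> Prop) n : P n ->
  exists m, [/\ P m, m <= n & forall k, P k -> m <= k].
Proof.
elim/ltn_ind: n => n IH Pn.
have [[m [lt_mn Pm]]|no] := classic (exists m, m < n /\ P m).
  by have [k [? ? ?]] := IH m lt_mn Pm; exists k; split=> //; lia.
exists n; split=> // k Pk; rewrite leqNgt; apply/negP => lt_kn.
by apply: no; exists k.
Qed.

(** A witness excludes the default branch of [least]; values of [qcard], [qexp] and [qrank] are
    reached this way. *)
Lemma leastP (P : nat -> Prop) n : P n -> P (least P) /\ least P <= n.
Proof.
rewrite /least => Pn; case: excluded_middle_informative => [h|[]]; last first.
  by have [m [Pm _ min]] := ex_least Pn; exists m.
by case: constructive_indefinite_description => m [Pm min] /=; split=> //; apply: min.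
Qed.

Lemma gpowD (F : grp) (x : F) m n : gpow x (m + n) = gpow x m ** gpow x n.
Proof. by elim: m => [|m IH] /=; rewrite ?gmul1 // IH gmulA. Qed.

Lemma gpowM (F : grp) (x : F) m n : gpow x (m * n) = gpow (gpow x m) n.
Proof. by elim: n => [|n IH] /=; rewrite ?muln0 // mulnS gpowD IH. Qed.

Lemma gpow_in (F : grp) (U : fset F) x n : subgroupF U -> U x -> U (gpow x n).
Proof. by case=> U1 UM _ Ux; elim: n => //= n IH; apply: UM. Qed.

(** * Numbers of generators of quotients and of their subgroups *)

Definition span (F : grp) (f : nat -> F) (k : nat) (B : fset F) : fset F :=
  gen (fun x => (exists2 i, i < k & x = f i) \/ B x).

Definition fgenF (F : grp) (A B : fset F) (k : nat) : Prop :=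
  exists f : nat -> F, (forall i, i < k -> A (f i)) /\ forall a, A a -> span f k B a.

(** All subgroups of [A] are covered because d can grow on passing to a subgroup, and M^(c)(G) is
    only a subgroup of D_0 / D_t. *)
Definition rankF (F : grp) (A B : fset F) (k : nat) : Prop :=
  forall S, subgroupF S -> subF S A -> fgenF S B k.

Lemma rank_mono (F : grp) (A A' B B' : fset F) k :
  subF A A' -> subF B' B -> rankF A' B' k -> rankF A B k.
Proof.
move=> AA BB rk S sS SA; have [f [Sf gf]] := rk S sS (fun x Sx => AA x (SA x Sx)).
exists f; split=> // a /gf; apply: gen_mono => x [|/BB]; [by left | by right].
Qed.

(** Normality lets each factor from [B] be pushed to the right of a word in [S]. *)
Lemma gen_mul_normal (F : grp) (S B : fset F) a : normalF B ->
  gen (fun x => S x \/ B x) a -> exists w b, [/\ gen S w, B b & a = w ** b].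
Proof.
case=> -[B1 BM BV] BJ; elim=> [x [Sx|Bx]||x y _ [w [b [gw Bb ->]]] _ [v [d [gv Bd ->]]]
  |x _ [w [b [gw Bb ->]]]].
- by exists x, gone; split; [apply: gen_in | | rewrite gmulr1].
- by exists gone, x; split; [apply: gen_one | | rewrite gmul1].
- by exists gone, gone; split; [apply: gen_one | | rewrite gmul1].
- exists (w ** v), ((ginv v ** b ** v) ** d); split; first exact: gen_mul.
    by apply: BM => //; apply: BJ.
  by rewrite !gmulA gmulrK.
- exists (ginv w), (ginv (ginv w) ** ginv b ** ginv w); split; first exact: gen_inv.
    by apply: BJ; apply: BV.
  by rewrite !gnormE.
Qed.

(** Generators of [S] modulo [B], taken in [S], together with generators modulo [C] of the
    intersection of [S] and [B], generate [S] modulo [C]. *)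
Lemma rank_trans (F : grp) (A B C : fset F) k l : normalF B ->
  rankF A B k -> rankF B C l -> rankF A C (k + l).
Proof.
move=> nB rAB rBC S sS SA; have [f [Sf gf]] := rAB S sS SA.
have [g [Sg gg]] := rBC _ (cap_subgroup sS nB.1) (fun x h => h.2).
pose h i := if i < k then f i else g (i - k).
have fh : subF (gen (fun x => exists2 i, i < k & x = f i)) (span h (k + l) C).
  apply: gen_mono => _ [i lt_ik ->]; left; exists i; first by lia.
  by rewrite /h lt_ik.
have gh : subF (span g l C) (span h (k + l) C).
  apply: gen_mono => x [[i lt_il ->]|Cx]; [left | by right].
  exists (k + i); first by rewrite ltn_add2l.
  by rewrite /h ltnNge leq_addr addKn.
exists h; split=> [i lt_ikl|a Sa].
  by rewrite /h; case: ltnP => ?; [apply: Sf | case: (Sg (i - k)) => //; lia].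
have [w [b [gw Bb eab]]] := gen_mul_normal nB (gf a Sa).
have Sw : S w by move: w gw {eab}; apply: gen_sub => // _ [i lt_ik ->]; apply: Sf.
have Sb : S b.
  case: (sS) => _ SM SV.
  have -> : b = ginv w ** a by rewrite eab gmulVK.
  by apply: (SM) => //; apply: SV.
by rewrite eab; apply: gen_mul; [apply: fh | apply: gh; apply: gg; split].
Qed.

(** Modulo [B] the element is an integer power of [x]; there are two cases because [gpow] has
    natural exponents. *)
Lemma cyclic_form (F : grp) (x : F) (B : fset F) a : normalF B ->
  gen (fun y => y = x \/ B y) a ->
  exists m b, B b /\ (a = gpow x m ** b \/ ginv a = gpow x m ** b).
Proof.
move=> nB ga; case: (nB) => -[B1 BM BV] BJ.
have [w [b [gw Bb ->]]] := gen_mul_normal nB ga.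
have xC m : gpow x m ** x = x ** gpow x m.
  by have := gpowD x m 1; rewrite /= gmulr1 => <-; rewrite addn1.
have {gw} [m [->|->]] : exists m, w = gpow x m \/ w = ginv (gpow x m).
  have powC m n : gpow x m ** gpow x n = gpow x n ** gpow x m.
    by rewrite -!gpowD addnC.
  have dif m n : exists k, gpow x m ** ginv (gpow x n) = gpow x k \/
      gpow x m ** ginv (gpow x n) = ginv (gpow x k).
    case: (leqP n m) => [le_nm|/ltnW le_mn].
      by exists (m - n); left; rewrite -{1}(subnK le_nm) gpowD !gnormE.
    exists (n - m); right; rewrite -{1}(subnKC le_mn) addnC gpowD ginvM.
    by rewrite gmulA gmulrV gmul1.
  elim: gw => [y ->||y z _ [m ey] _ [n ez]|y _ [m [->|->]]].
  - by exists 1; left; rewrite /= gmulr1.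
  - by exists 0; left.
  - case: ey => ->; case: ez => ->.
    + by exists (m + n); left; rewrite gpowD.
    + exact: dif.
    + have -> : ginv (gpow x m) ** gpow x n = gpow x n ** ginv (gpow x m).
        by apply: (@gmul_cancel _ (gpow x m)); rewrite gmulA gmulrV gmul1 gmulA powC gmulrK.
      exact: dif.
    + by exists (n + m); right; rewrite gpowD ginvM.
  - by exists m; right.
  - by exists m; left; rewrite ginvK.
- by exists m, b; split=> //; left.
- exists m, (ginv (gpow x m) ** ginv b ** gpow x m); split.
    by apply: BJ; apply: BV.
  by right; rewrite !gnormE.
Qed.

(** Subgroups of cyclic groups are cyclic: the generator is the least positive power of [x] that
    lies in [S] up to a factor from [B]. *)
Lemma rank_cyclic (F : grp) (x : F) (B : fset F) : normalF B ->
  rankF (gen (fun y => y = x \/ B y)) B 1.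
Proof.
move=> nB S sS SA; case: (sS) => S1 SM SV; case: (nB) => -[B1 BM BV] BJ.
pose P n := 0 < n /\ exists2 b, B b & S (gpow x n ** b).
(* Since [T] is closed under inverses, only the elements x^m b of [S] need testing. *)
have up T : subgroupF T -> (forall m b, B b -> S (gpow x m ** b) -> T (gpow x m ** b)) ->
    subF S T.
  case=> T1 TM TV H a Sa; have [m [b [Bb [ea|ea]]]] := cyclic_form nB (SA a Sa).
    by rewrite ea; apply: H; rewrite -?ea.
  by rewrite -[a]ginvK; apply: TV; rewrite ea; apply: H; rewrite -?ea //; apply: SV.
have [[n Pn]|noP] := classic (exists n, P n); last first.
  exists (fun=> gone); split=> // a; move: a; apply: up; first exact: gen_subgroup.
  case=> [|m] b Bb Sb; first by rewrite gmul1; apply: gen_in; right.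
  by case: noP; exists m.+1; split=> //; exists b.
have [d [[d0 [b0 Bb0 Sd]] _ mind]] := ex_least Pn.
exists (fun=> gpow x d ** b0); split=> // a; move: a; apply: up; first exact: gen_subgroup.
elim/ltn_ind => m IH b Bb Sb.
have [le_dm|lt_md] := leqP d m; last first.
  case: m {IH} Sb lt_md => [|m] Sb lt_md; first by rewrite gmul1; apply: gen_in; right.
  suff : d <= m.+1 by rewrite leqNgt lt_md.
  by apply: mind; split=> //; exists b.
(* Division by d as repeated subtraction: splitting off x^d b0 leaves x^(m-d) times an element of
   [B]. *)
have e : gpow x m ** b = gpow x d ** b0 ** (gpow x (m - d) **
    (ginv (gpow x (m - d)) ** ginv b0 ** gpow x (m - d) ** b)).
  by rewrite -{1}(subnKC le_dm) gpowD !gnormE.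
have Bb' : B (ginv (gpow x (m - d)) ** ginv b0 ** gpow x (m - d) ** b).
  by apply: BM => //; apply: BJ; apply: BV.
rewrite e; apply: gen_mul; first by apply: gen_in; left; exists 0.
apply: IH => //; first by lia.
move: Sb; rewrite e => Sb; have := SM _ _ (SV _ Sd) Sb; by rewrite gmulVK.
Qed.

Lemma central_span_normal (F : grp) (f : nat -> F) k (B : fset F) : normalF B ->
  (forall i g, i < k -> B (gcomm (f i) g)) -> normalF (span f k B).
Proof.
move=> nB cf; apply: gen_normal => x g [[i lt_ik ->]|Bx]; last first.
  by apply: gen_in; right; apply: nB.2.
have -> : ginv g ** f i ** g = f i ** gcomm (f i) g by rewrite /gcomm !gnormE.
by apply: gen_mul; apply: gen_in; [left; exists i | right; apply: cf].
Qed.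

(** The generators are added one at a time; each stage is normal, as they are central modulo [B],
    and cyclic over the one before. *)
Lemma rank_central (F : grp) (f : nat -> F) k (B : fset F) : normalF B ->
  (forall i g, i < k -> B (gcomm (f i) g)) -> rankF (span f k B) B k.
Proof.
move=> nB; elim: k => [|k IH] cf.
  by move=> S _ SA; exists f; split=> // a /SA; apply: gen_mono => x [[]|].
have cfk i g : i < k -> B (gcomm (f i) g) by move=> ?; apply: cf; lia.
rewrite -add1n; have nBk := central_span_normal nB cfk.
apply: rank_trans (nBk) _ (IH cfk).
apply: (rank_mono _ _ (rank_cyclic (x := f k) nBk)) => //.
apply: gen_sub; first exact: gen_subgroup.
move=> x [[i lt_ik ->]|Bx].
  have [->|ne_ik] := eqVneq i k; first by apply: gen_in; left.
  by apply: gen_in; right; apply: gen_in; left; exists i => //; lia.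
by apply: gen_in; right; apply: gen_in; right.
Qed.

(** The bound [n] ensures that [qrank A B] is attained by actual generators; these are central
    modulo [B], so [rank_central] carries the same number over to all subgroups. *)
Lemma rank_qrank (F : grp) (A B : fset F) n : subgroupF A -> normalF B ->
  (forall a g, A a -> B (gcomm a g)) -> rankF A B n -> rankF A B (qrank A B).
Proof.
move=> sA nB cA rk.
have [[f [Af gf]] _] := leastP (rk A sA (fun _ h => h)).
apply: (rank_mono _ _ (rank_central (f := f) nB _)) => //.
by move=> i g lt_i; apply: cA; apply: Af.
Qed.

Lemma qrank_le (F : grp) (A B : fset F) n : fgenF A B n -> qrank A B <= n.
Proof. by move=> fg; have [] := leastP fg. Qed.

(** * Exponents of quotients *)

Lemma qexp_in (F : grp) (A B : fset F) a :
  subgroupF B -> A a -> B (gpow a (qexp A B)).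
Proof.
move=> sB Aa.
have [[n Pn]|no] := classic (exists e, 0 < e /\ forall a, A a -> B (gpow a e)).
  by have [[_ H] _] := leastP (P := fun e => 0 < e /\ forall a, A a -> B (gpow a e)) Pn; apply: H.
(* Without a finite exponent [qexp] is 0, and the power with exponent 0 is [gone]. *)
rewrite /qexp /least; case: excluded_middle_informative => [h|_].
  by case: no; case: h => n [Pn _]; exists n.
by case: sB.
Qed.

(** For positive [n], a nonzero remainder of [n] modulo [qexp A B] would be a smaller exponent; for
    [n] = 0, every number divides 0. *)
Lemma qexp_dvd (F : grp) (A B : fset F) n :
  subgroupF B -> (forall a, A a -> B (gpow a n)) -> qexp A B %| n.
Proof.
move=> sB H; case: (sB) => B1 BM BV; case: n H => // n H.
have [[q0 Hq] _] := leastP (P := fun e => 0 < e /\ forall a, A a -> B (gpow a e))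
  (conj isT H : (0 < n.+1) /\ _).
rewrite -/(qexp A B) in q0 Hq.
have := ltn_pmod n.+1 q0; rewrite /dvdn; case: posnP => // r0 lt_r.
have Pr : 0 < n.+1 %% qexp A B /\ forall a, A a -> B (gpow a (n.+1 %% qexp A B)).
  split=> // a Aa.
  have e : gpow a n.+1 = gpow a (n.+1 %/ qexp A B * qexp A B) ** gpow a (n.+1 %% qexp A B).
    by rewrite -gpowD -divn_eq.
  rewrite -[X in B X](gmulVK (gpow a (n.+1 %/ qexp A B * qexp A B))) -e.
  apply: BM; last exact: H.
  apply: BV; rewrite mulnC gpowM; apply: gpow_in; [exact: sB | exact: Hq].
by have [_] := leastP (P := fun e => 0 < e /\ forall a, A a -> B (gpow a e)) Pr; rewrite -/(qexp A B) leqNgt lt_r.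
Qed.

(** * Orders of quotients *)

Lemma qorder_thin (F : grp) (A B : fset F) f n : subgroupF B ->
  (forall i, i < n -> A (f i)) ->
  exists m g, [/\ forall i, i < m -> A (g i),
    forall i j, i < m -> j < m -> B (ginv (g i) ** g j) -> i = j
    & forall i, i < n -> exists2 j, j < m & B (ginv (g j) ** f i)].
Proof.
case=> B1 BM BV; elim: n => [|n IH] Af; first by exists 0, f.
have [|m [g [Ag injg covg]]] := IH; first by move=> i lt_in; apply: Af; lia.
(* The last entry is dropped if its coset is already represented, and appended otherwise. *)
have [[j lt_jm Bj]|no] := classic (exists2 j, j < m & B (ginv (g j) ** f n)).
  exists m, g; split=> // i; rewrite ltnS leq_eqVlt => /orP[/eqP->|]; last exact: covg.
  by exists j.
exists m.+1, (fun i => if i < m then g i else f n); split=> [i lt_i|i j lt_i lt_j|i lt_i].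
- by case: ltnP => ?; [apply: Ag | apply: Af].
- case: ltnP => hi; case: ltnP => hj H.
  + exact: injg.
  + by case: no; exists i.
  + by case: no; exists j => //; have := BV _ H; rewrite !gnormE.
  + lia.
- have [->|ne] := eqVneq i n.
    by exists m => //; rewrite ltnn gmulV.
  have [|j lt_j Bj] := covg i; first by lia.
  by exists j; [lia | rewrite lt_j].
Qed.

Lemma qorder_cover (F : grp) (A B : fset F) f n : subgroupF B ->
  (forall i, i < n -> A (f i)) ->
  (forall a, A a -> exists2 i, i < n & B (ginv (f i) ** a)) ->
  exists m, qorder A B m.
Proof.
move=> sB Af covf; have [m [g [Ag injg covg]]] := qorder_thin sB Af.
exists m, g; split=> //; split=> // a /covf[i /covg[j lt_j Bj] Bi].
exists j => //; case: sB => _ BM _; have := BM _ _ Bj Bi; by rewrite !gnormE.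
Qed.

Lemma qorder_le (F : grp) (A B : fset F) m n : subgroupF B ->
  qorder A B m -> qorder A B n -> m <= n.
Proof.
case=> _ BM BV [f [Af [injf _]]] [g [_ [_ covg]]].
have [h Bh] : exists h : 'I_m -> 'I_n, forall i, B (ginv (g (h i)) ** f i).
  have := @fin_all_exists 'I_m (fun=> 'I_n) (fun i j => B (ginv (g j) ** f i)).
  apply=> i.
  by have [j lt_j Bj] := covg _ (Af i (ltn_ord i)); exists (Ordinal lt_j).
rewrite -[m]card_ord -[n]card_ord; apply: (@leq_card _ _ h) => i j eh.
apply/val_inj/injf; rewrite ?ltn_ord //.
have := BM _ _ (BV _ (Bh i)) (Bh j); rewrite eh.
by rewrite !gnormE.
Qed.

Lemma qcard_qorder (F : grp) (A B : fset F) n : subgroupF B ->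
  qorder A B n -> qcard A B = n.
Proof.
move=> sB qn; have [q _] := leastP qn.
by apply/eqP; rewrite eqn_leq (qorder_le sB q qn) (qorder_le sB qn q).
Qed.

Lemma qcard_none (F : grp) (A B : fset F) : (forall n, ~ qorder A B n) -> qcard A B = 0.
Proof.
move=> no; rewrite /qcard /least; case: excluded_middle_informative => // h.
by exfalso; case: h => n [qn _]; case: (no n).
Qed.

(** The tower law holds for infinite quotients too: A/C is finite exactly when A/B and B/C are, so
    otherwise both sides are 0. *)
Lemma qcard_trans (F : grp) (A B C : fset F) :
  subgroupF A -> subgroupF B -> subgroupF C -> subF B A -> subF C B ->
  qcard A C = qcard A B * qcard B C.
Proof.
move=> [A1 AM AV] sB sC BA CB; case: (sB) => B1 BM BV; case: (sC) => C1 CM CV.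
have main m l : qorder A B m -> qorder B C l -> qcard A C = qcard A B * qcard B C.
  move=> qAB qBC; rewrite (qcard_qorder sB qAB) (qcard_qorder sC qBC).
  apply: (qcard_qorder sC); case: qAB qBC => [f [Af [injf covf]]] [g [Bg [injg covg]]].
  (* The representative of index k = i l + j is f_i g_j. *)
  exists (fun k => f (k %/ l) ** g (k %% l)); split=> [i lt_i|].
    by apply: AM; [apply: Af; rewrite ltn_divLR //; nia | apply: BA; apply: Bg; apply: ltn_pmod; nia].
  split=> [i j lt_i lt_j Cij|a Aa].
    have l0 : 0 < l by nia.
    have [ri rj] : i %% l < l /\ j %% l < l by rewrite !ltn_pmod.
    have eq1 : i %/ l = j %/ l.
      apply: injf; rewrite ?ltn_divLR //.
      have := BM _ _ (BM _ _ (Bg _ ri) (CB _ Cij)) (BV _ (Bg _ rj)).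
      by rewrite !gnormE.
    have eq2 : i %% l = j %% l.
      by apply: injg => //; move: Cij; rewrite eq1 !gnormE.
    by rewrite (divn_eq i l) (divn_eq j l) eq1 eq2.
  have [i lt_i Bi] := covf a Aa; have [j lt_j Cj] := covg _ Bi.
  have l0 : 0 < l by lia.
  exists (i * l + j); first by nia.
  by rewrite divnMDl // divn_small // addn0 modnMDl modn_small // ginvM -gmulA.
have [[n qAC]|noAC] := classic (exists n, qorder A C n).
  have [f [Af [injf covf]]] := qAC.
  have [m qAB] : exists m, qorder A B m.
    apply: (qorder_cover sB Af) => a /covf[i lt_i Ci]; exists i => //; exact: CB.
  (* [g] picks an element of [B] in each coset f_i C that meets [B]; these elements cover [B] modulo
     [C]. *)
  have [g gP] : exists g : nat -> F, forall i,
      (exists2 b, B b & C (ginv (f i) ** b)) -> B (g i) /\ C (ginv (f i) ** g i).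
    have H i : exists b', (exists2 b, B b & C (ginv (f i) ** b)) ->
        B b' /\ C (ginv (f i) ** b').
      have [[b Bb Cb]|no] := classic (exists2 b, B b & C (ginv (f i) ** b)).
        by exists b.
      by exists gone => /no.
    exists (fun i => proj1_sig (constructive_indefinite_description _ (H i))) => i.
    exact: proj2_sig (constructive_indefinite_description _ (H i)).
  have [l qBC] : exists l, qorder B C l.
    pose g' i := if excluded_middle_informative (B (g i)) then g i else gone.
    have Bg' i : B (g' i) by rewrite /g'; case: excluded_middle_informative.
    apply: (@qorder_cover _ B C g' n) => // b Bb.
    have [i lt_i Ci] := covf b (BA b Bb); exists i => //.
    have [Bg Cg] := gP i (ex_intro2 _ _ b Bb Ci).
    have -> : g' i = g i by rewrite /g'; case: excluded_middle_informative.
    by have := CM _ _ (CV _ Cg) Ci; rewrite !gnormE.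
  exact: main qAB qBC.
have [[m qAB]|noAB] := classic (exists n, qorder A B n); last first.
  rewrite (@qcard_none _ A B) => [|m qm]; last by apply: noAB; exists m.
  by rewrite qcard_none // => n qn; apply: noAC; exists n.
have [[l qBC]|noBC] := classic (exists n, qorder B C n); last first.
  rewrite (@qcard_none _ B C) => [|m' qm]; last by apply: noBC; exists m'.
  by rewrite muln0 qcard_none // => n qn; apply: noAC; exists n.
exact: main qAB qBC.
Qed.

Lemma qcard_refl (F : grp) (A : fset F) : subgroupF A -> qcard A A = 1.
Proof.
move=> sA; apply: qcard_qorder => //; case: sA => A1 AM AV.
exists (fun=> gone); split=> //; split=> [[|i] [|j] //|a Aa].
by exists 0; rewrite // ginv1 gmul1.
Qed.

(** * Chains of subgroups *)

Lemma chain_sub (F : grp) (D : nat -> fset F) j k :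
  (forall k, subF (D k.+1) (D k)) -> j <= k -> subF (D k) (D j).
Proof.
move=> DS /subnK <-; elim: (k - j) => [x //|m IH x].
by rewrite addSn => /DS/IH.
Qed.

Lemma qcard_chain (F : grp) (D : nat -> fset F) t :
  (forall k, subgroupF (D k)) -> (forall k, subF (D k.+1) (D k)) ->
  qcard (D 0) (D t) = \prod_(0 <= k < t) qcard (D k) (D k.+1).
Proof.
move=> sD DS; elim: t => [|t IH]; first by rewrite big_geq // qcard_refl.
rewrite big_nat_recr //= -IH; by apply: qcard_trans => //; apply: chain_sub.
Qed.

Lemma qexp_chain (F : grp) (D : nat -> fset F) t a :
  (forall k, subgroupF (D k)) -> D 0 a ->
  D t (gpow a (\prod_(0 <= k < t) qexp (D k) (D k.+1))).
Proof.
move=> sD Da; elim: t => [|t IH]; first by rewrite big_geq //= gmulr1.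
by rewrite big_nat_recr //= gpowM; apply: qexp_in.
Qed.

Lemma rank_chain (F : grp) (D : nat -> fset F) (r : nat -> nat) t :
  (forall k, normalF (D k)) -> (forall k, k < t -> rankF (D k) (D k.+1) (r k)) ->
  rankF (D 0) (D t) (\sum_(0 <= k < t) r k).
Proof.
move=> nD; elim: t => [|t IH] rD.
  rewrite big_geq // => S _ SD; exists (fun=> gone); split=> // a /SD Da.
  by apply: gen_in; right.
rewrite big_nat_recr //=; apply: rank_trans (nD t) _ (rD t (ltnSn t)).
by apply: IH => k lt_kt; apply: rD; apply: ltnW.
Qed.

(** * The terms D_k and finite generation of D_0 modulo D_t *)

Lemma comm_join_sub (F : grp) (R : fset F) k : normalF R ->
  subF (commF (joinF (citer (@fullF F) k) R) (@fullF F))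
       (joinF (citer (@fullF F) k.+1) R).
Proof.
move=> nR; have nJ := join_normal (citer_normal k.+1 (full_normal F)) nR.
apply: comm_sub => [|u v Ju _]; first exact: nJ.1.
apply: gen_comml Ju => // {}u {}v [cu|Ru].
- by apply: joinl; apply: comm_in.
- by apply: joinr; apply: normal_commr.
Qed.

Lemma fac_normal (F : grp) (R : fset F) c k : normalF R -> normalF (facF c R k).
Proof.
move=> nR; apply/citer_normal/join_normal => //.
rewrite gammaFS; exact: citer_normal.
Qed.

Lemma facS_sub (F : grp) (R : fset F) c k : normalF R -> subF (facF c R k.+1) (facF c R k).
Proof.
move=> nR; apply: citer_mono; rewrite !gammaFS.
apply: join_sub; first exact: gen_subgroup; last exact: joinr.
by move=> x /citerS_sub cx; apply: joinl; apply: cx.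
Qed.

(** [D_k, F] = [[gamma_(k+1)(F) R, F], _c F], and the inner commutator lies in gamma_(k+2)(F) R. *)
Lemma fac_central (F : grp) (R : fset F) c k a g : normalF R ->
  facF c R k a -> facF c R k.+1 (gcomm a g).
Proof.
move=> nR Da.
have : citer (joinF (gammaF k.+1) R) c.+1 (gcomm a g) by apply: comm_in.
rewrite -[c.+1]addn1 citerD !gammaFS; apply: citer_mono; rewrite gammaFS.
exact: comm_join_sub.
Qed.

Lemma fac0 (F : grp) (R : fset F) c : facF c R 0 = citer (@fullF F) c.
Proof.
by apply: fset_eq; apply: citer_mono => // x _; apply: joinl.
Qed.

Lemma join_absorb (F : grp) (U R : fset F) : normalF R -> subF U R -> joinF U R = R.
Proof.
move=> nR UR; apply: fset_eq; last exact: joinr.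
by apply: join_sub => //; exact: nR.1.
Qed.

(* The generators are the left-normed commutators of weight i + 1 in the tau j. *)
Lemma citer_fgen (F : grp) (R : fset F) (tau : nat -> F) n i : normalF R ->
  (forall x, span tau n R x) ->
  exists k, fgenF (citer (@fullF F) i) (joinF (citer (@fullF F) i.+1) (citer R i)) k.
Proof.
move=> nR gtau; elim: i => [|i [k [f [cf gf]]]].
  exists n, tau; split=> // a _; apply: gen_mono (gtau a) => x [|Rx]; first by left.
  by right; apply: joinr.
pose h j := gcomm (f (j %/ n)) (tau (j %% n)).
have nfull := full_normal F.
set K := joinF _ _; have nK : normalF K by apply: join_normal; apply: citer_normal.
have ch j : j < k * n -> citer (@fullF F) i.+1 (h j).
  by move=> lt_j; apply: comm_in => //; apply: cf; rewrite ltn_divLR //; nia.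
(* The h_j are central modulo gamma_(i+3)(F), so their span over [K] is normal and commutators can
   be tested on generators. *)
have nL : normalF (span h (k * n) K).
  apply: central_span_normal => // j g lt_j; apply: joinl.
  by apply: comm_in => //; apply: ch.
have KL : subF K (span h (k * n) K) by move=> x Kx; apply: gen_in; right.
exists (k * n), h; split=> //.
apply: comm_sub => [|u v cu _]; first exact: nL.1.
apply: gen_comml (gf u cu) => // {cu} {}u {}v [[j lt_j ->]|Ku].
- move: v (gtau v); apply: gen_sub; first exact: commr_subgroup.
  move=> v [[l lt_l ->]|Rv].
    apply: gen_in; left; exists (j * n + l); first by nia.
    by rewrite /h divnMDl ?modnMDl ?divn_small ?modn_small ?addn0 //; lia.
  (* Here [v] lies in [R]: its commutator with an element of gamma_(i+1)(F) falls in [R, _(i+1) F],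
     which is part of [K]. *)
  apply: commC nL.1 _; apply: KL; apply: joinr; apply: comm_citer => //; exact: cf.
- apply: gen_comml Ku => // {}u {}v [cu|cu].
  + by apply: KL; apply: joinl; apply: comm_in.
  + by apply: KL; apply: joinr; apply: comm_in.
Qed.

(** Along E_s = gamma_(c+s+1)(F) [R, _c F], each E_s / E_(s+1) is finitely generated and central in
    F / E_(s+1), and E_t = [R, _c F]. *)
Lemma rank_citer (F : grp) (R : fset F) (tau : nat -> F) n c t : normalF R ->
  (forall x, span tau n R x) -> subF (citer (@fullF F) t) R ->
  exists k, rankF (citer (@fullF F) c) (citer R c) k.
Proof.
move=> nR gtau tR; have nfull := full_normal F.
pose E s := joinF (citer (@fullF F) (c + s)) (citer R c).
have nE s : normalF (E s) by apply: join_normal; apply: citer_normal.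
have rE s : exists k, rankF (E s) (E s.+1) k.
  have [k [f [cf gf]]] := citer_fgen (c + s) nR gtau.
  exists k; apply: (rank_mono _ _ (rank_central (f := f) (nE s.+1) _)) => //.
    apply: join_sub; first exact: gen_subgroup.
      move=> a /gf; apply: gen_mono => x [|Kx]; [by left | right; move: x Kx].
      apply: join_sub; first exact: gen_subgroup.
        by rewrite -addnS; exact: joinl.
      by move=> x cx; apply: joinr; move: cx; apply: citer_anti => //; lia.
    by move=> x cx; apply: gen_in; right; apply: joinr.
  by move=> j g lt_j; apply: joinl; rewrite addnS; apply: comm_in => //; apply: cf.
pose r s := proj1_sig (constructive_indefinite_description _ (rE s)).
have rP s : rankF (E s) (E s.+1) (r s).
  exact: proj2_sig (constructive_indefinite_description _ (rE s)).
exists (\sum_(0 <= s < t) r s).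
apply: (rank_mono _ _ (rank_chain (D := E) nE (fun s _ => rP s))).
  by rewrite /E addn0; exact: joinl.
apply: join_sub => //; first by case: (citer_normal c nR).
by rewrite citerD; apply: citer_mono.
Qed.

(** * Images of the lower central series in a finite group *)

Lemma ker_normal (F : grp) (gT : finGroupType) (f : F -> gT) :
  is_hom_fin f -> normalF (kerF f).
Proof.
move=> hf; rewrite /kerF; split=> [|x g fx]; last by rewrite !hf fx mulg1 -hf gmulV hom_one.
split=> [|x y fx fy|x fx]; first exact: hom_one.
  by rewrite hf fx fy mulg1.
by rewrite hom_inv // fx invg1.
Qed.

Lemma hom_citer (F : grp) (gT : finGroupType) (G : {group gT}) (f : F -> gT) n x :
  is_hom_fin f -> (forall y, f y \in G) ->
  citer (@fullF F) n x -> f x \in ('L_n.+1(G))%g.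
Proof.
move=> hf fG; elim: n x => [|n IH] x; first by move=> _; rewrite lcn1.
rewrite lcnSn; move: x; apply: comm_sub => [|u v /IH Lu _].
  split=> [|x y fx fy|x fx]; first by rewrite hom_one // group1.
    by rewrite hf groupM.
  by rewrite hom_inv // groupV.
by rewrite hom_comm // mem_commg.
Qed.

(** In the inductive step an element of ['L_n.+2(G)] is a finite product of commutators, whose
    entries lift separately. *)
Lemma lcn_lift (F : grp) (gT : finGroupType) (G : {group gT}) (f : F -> gT) n g :
  is_hom_fin f -> (forall g, g \in G -> exists x, f x = g) ->
  g \in ('L_n.+1(G))%g -> exists2 x, citer (@fullF F) n x & f x = g.
Proof.
move=> hf fG; elim: n g => [|n IH] g.
  by rewrite lcn1 => /fG[x <-]; exists x.
rewrite lcnSn => /gen_prodgP[m [a La ->]].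
apply: (big_ind (fun g => exists2 x, citer (@fullF F) n.+1 x & f x = g)) => [|_ _ [x cx <-] [y cy <-]|i _].
- by exists gone; [apply: gen_one | apply: hom_one].
- by exists (x ** y); [apply: gen_mul | rewrite hf].
- have /imset2P[u v /IH[x cx <-] /fG[y <-] ->] := La i.
  by exists (gcomm x y); [apply: comm_in | rewrite hom_comm].
Qed.

(** [f] maps gamma_(n+1)(F) onto gamma_(n+1)(G); a section [U] of this map, read along an
    enumeration of the image, is the transversal. *)
Lemma qcard_lcn (F : grp) (gT : finGroupType) (G : {group gT}) (f : F -> gT) n :
  is_hom_fin f -> (forall y, f y \in G) -> (forall g, g \in G -> exists x, f x = g) ->
  qcard (citer (@fullF F) n) (capF (kerF f) (citer (@fullF F) n)) = #|('L_n.+1(G))%g|.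
Proof.
move=> hf fG Gf; have [sC _] := citer_normal n (full_normal F).
apply: qcard_qorder; first by apply: cap_subgroup sC; case: (ker_normal hf).
have [U HU] : exists U : gT -> F, forall g, g \in ('L_n.+1(G))%g ->
    citer (@fullF F) n (U g) /\ f (U g) = g.
  have := @fin_all_exists gT (fun=> F) (fun g y => g \in ('L_n.+1(G))%g ->
    citer (@fullF F) n y /\ f y = g); apply=> g.
  have [/(lcn_lift hf Gf)[x cx fx]|] := boolP (g \in ('L_n.+1(G))%g); first by exists x.
  by exists gone.
case: (sC) => _ CM CV.
pose e i := nth 1%g (enum ('L_n.+1(G))%g) i.
have Le i : i < #|('L_n.+1(G))%g| -> e i \in ('L_n.+1(G))%g.
  by move=> lt_i; rewrite -mem_enum mem_nth -?cardE.
exists (fun i => U (e i)); split; last split.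
- by move=> i /Le/HU[].
- move=> i j lt_i lt_j [+ _]; rewrite /kerF hf hom_inv // !(HU _ (Le _ _)).2 //.
  move/eqP; rewrite -eq_mulVg1 => /eqP eij.
  apply/eqP; rewrite -(nth_uniq 1%g _ _ (enum_uniq ('L_n.+1(G))%g)) -?cardE //.
  by apply/eqP.
- move=> a ca; have La := hom_citer hf fG ca.
  exists (index (f a) (enum ('L_n.+1(G))%g)).
    by rewrite cardE index_mem mem_enum.
  rewrite /e nth_index ?mem_enum //; have [cU fU] := HU _ La.
  split; first by rewrite /kerF hf hom_inv // fU mulVg.
  by apply: (CM) => //; apply: CV.
Qed.

(** * The three claims along the chain D_k *)

Theorem theorem24 (F : grp) (gT : finGroupType) (G : {group gT})
    (pi : F -> gT) (c t : nat) :
  1 <= c -> 2 <= t -> nilpotent G -> nil_class G = t ->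
  is_free F -> is_hom_fin pi ->
  (forall x, pi x \in G) -> (forall g, g \in G -> exists x, pi x = g) ->
  let R := kerF pi in
  (* kernel of the induced presentation F -> G -> G/G' *)
  let Rab := kerF (fun x => coset (G^`(1))%g (pi x)) in
  let fac := facF c R in
  [/\ #|('L_c.+1(G))%g| * qcard (Mc_num c R) (Mc_den c R)
        = qcard (Mc_num c Rab) (Mc_den c Rab)
          * \prod_(1 <= k < t) qcard (fac k) (fac k.+1),
      qexp (Mc_num c R) (Mc_den c R)
        %| qexp (Mc_num c Rab) (Mc_den c Rab)
           * \prod_(1 <= k < t) qexp (fac k) (fac k.+1)
    & qrank (Mc_num c R) (Mc_den c R)
        <= qrank (Mc_num c Rab) (Mc_den c Rab)
           + \sum_(1 <= k < t) qrank (fac k) (fac k.+1)].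
Proof.
move=> c1 t2 nilG clG _ hpi piG Gpi R Rab fac.
have t0 : 0 < t by apply: ltnW.
have nR : normalF R := ker_normal hpi.
have nfull := full_normal F.
(* [citer fullF t] is gamma_(t+1)(F); it maps into ['L_t.+1(G)], which is trivial in class [t]. *)
have tR : subF (citer (@fullF F) t) R.
  move=> x /(hom_citer hpi piG); have /(lcn_nil_classP t nilG) -> := eq_leq clG.
  by move/set1P.
have RabE : Rab = joinF (gammaF 2) R.
  (* [coset] sends elements outside the normaliser to 1 as well, so its kernel gives membership in
     G' only for elements that normalise G'. *)
  have nG' x : pi x \in ('N(G^`(1)))%g by apply: (subsetP (der_norm 1 G)).
  apply: fset_eq => [x /(coset_idr (nG' x))|].
    move=> G'x; have /(lcn_lift hpi Gpi)[y cy fy] : pi x \in ('L_2(G))%g by rewrite lcn2.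
    have -> : x = y ** (ginv y ** x) by rewrite gmulA gmulrV gmul1.
    apply: gen_mul; first by apply: joinl; rewrite gammaFS.
    by apply: joinr; rewrite /R /kerF hpi hom_inv // fy mulVg.
  move=> x Jx; rewrite /Rab /kerF; apply: coset_id.
  move: x Jx; apply: join_sub => [|x|x Rx].
  - split=> [|x y px py|x px]; first by rewrite hom_one // group1.
      by rewrite hpi groupM.
    by rewrite hom_inv // groupV.
  - by rewrite gammaFS => /(hom_citer hpi piG); rewrite lcn2.
  - by rewrite Rx group1.
have numRab : Mc_num c Rab = fac 0.
  rewrite /Mc_num gammaFS /fac fac0; apply: fset_eq => [x []//|x cx]; split=> //.
  by rewrite RabE; apply: joinl; rewrite gammaFS; apply: citer_anti cx.
have denRab : Mc_den c Rab = fac 1 by rewrite /Mc_den RabE.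
have numR : Mc_num c R = capF R (fac 0) by rewrite /Mc_num gammaFS /fac fac0.
(* As gamma_(t+1)(F) <= R, the join inside D_t is [R] itself. *)
have denR : Mc_den c R = fac t.
  by rewrite /fac /facF join_absorb // gammaFS.
have nD k : normalF (fac k) by apply: fac_normal.
have sD k : subgroupF (fac k) := (nD k).1.
have DS k : subF (fac k.+1) (fac k) by apply: facS_sub.
have snum : subgroupF (capF R (fac 0)) := cap_subgroup nR.1 (sD 0).
have den_num : subF (fac t) (capF R (fac 0)).
  move=> x Dx; split; last exact: (chain_sub DS (leq0n t)).
  by move: Dx; rewrite -denR; apply: (citer_anti (m := 0)).
rewrite numRab denRab numR denR.
split.
(* |D_0 / D_t| is factored in two ways: through R /\ D_0, with first factor |gamma_(c+1)(G)|, and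
   along the chain, whose factor at k = 0 is |M^(c)(G/G')|. *)
- have -> : #|('L_c.+1(G))%g| = qcard (fac 0) (capF R (fac 0)).
    by rewrite /fac fac0 (qcard_lcn c hpi piG Gpi).
  rewrite -(qcard_trans (sD 0)) //; last by move=> x [].
  by rewrite qcard_chain // big_ltn.
- apply: qexp_dvd => // a [_ Da].
  by have := qexp_chain (D := fac) t sD Da; rewrite big_ltn.
(* A set-theoretic section of [pi] over [G]; its finitely many values generate F modulo R. *)
- have [U HU] : exists U : gT -> F, forall g, g \in G -> pi (U g) = g.
    have := @fin_all_exists gT (fun=> F) (fun g y => g \in G -> pi y = g); apply=> g.
    have [/Gpi[x <-]|] := boolP (g \in G); first by exists x.
    by exists gone.
  have gtau x : span (fun i => U (nth 1%g (enum gT) i)) #|gT| R x.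
    have -> : x = U (pi x) ** (ginv (U (pi x)) ** x) by rewrite gmulA gmulrV gmul1.
    apply: gen_mul; apply: gen_in; [left | right].
      exists (index (pi x) (enum gT)); first by rewrite cardE index_mem mem_enum.
      by rewrite nth_index // mem_enum.
    by rewrite /R /kerF hpi hom_inv // HU // mulVg.
  have [n rk] := rank_citer c nR gtau tR.
  have rD k : k < t -> rankF (fac k) (fac k.+1) (qrank (fac k) (fac k.+1)).
    (* D_k <= D_0 and D_t <= D_(k+1) turn the single bound [n] for D_0 modulo D_t into one for every
       factor. *)
    move=> lt_kt; apply: (@rank_qrank _ _ _ n) => // [a g|]; first exact: fac_central.
    rewrite -/(Mc_den c R) denR -(fac0 R) in rk.
    by apply: rank_mono rk; apply: chain_sub.
  have := rank_chain (D := fac) nD rD; rewrite big_ltn // => rk0.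
  (* The bound is applied to the subgroup R /\ D_0 of D_0, the numerator of M^(c)(G). *)
  by apply: qrank_le; apply: rk0 => // x [].
Qed.
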